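(* Let $P=\bigoplus_{k\ge0}R_k$ be an arbitrary $\mathbb{N}$-graded ring. The localisation $\lambda\colon P\to\tilde\Omega_+^{-1}P$ is the universal $P$-ring making $R_0$-contractible chain complexes contractible. That is: for every bounded complex $C^{+}$ of finitely generated free $P$-modules such that $C^{+}\otimes_PR_0$ is contractible, $C^{+}\otimes_P\tilde\Omega_+^{-1}P$ is contractible; and if $f\colon P\to S$ is a ring homomorphism such that for every bounded complex $C^{+}$ of finitely generated free $P$-modules, contractibility of $C^{+}\otimes_PR_0$ implies contractibility of $C^{+}\otimes_PS$, then there is a factorisation $f=\eta\circ\lambda$, $P\xrightarrow{\lambda}\tilde\Omega_+^{-1}P\xrightarrow{\eta}S$, with a uniquely determined ring homomorphism $\eta$.
   Context: All rings are unital (possibly non-commutative), ring homomorphisms preserve $1$, modules are right modules. $P=\bigoplus_{k\ge0}R_k$ is an $\mathbb{N}$-graded ring. A $P$-ring is a ring homomorphism with domain $P$. $\mathrm{tr}^0\colon P\to R_0$ is the ring homomorphism $\sum_k r_k\mapsto r_0$ (with $r_k\in R_k$); $C^{+}\otimes_PR_0$ is formed via $\mathrm{tr}^0$. $\tilde\Omega_+$ is the set of all square matrices $M$ (of arbitrary finite size) with entries in $P$ such that $\mathrm{tr}^0(M)$ (entrywise) is invertible over $R_0$; a matrix of size $k$ is regarded as a homomorphism $P^k\to P^k$. Non-commutative localisation: for a ring $K$ and a set $\Sigma$ of homomorphisms of finitely generated projective right $K$-modules, a ring homomorphism $f\colon K\to S$ is $\Sigma$-inverting if $\sigma\otimes_KS$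 is an isomorphism for all $\sigma\in\Sigma$; $\lambda_\Sigma\colon K\to\Sigma^{-1}K$ is the initial $\Sigma$-inverting ring homomorphism with domain $K$ (it always exists). $\lambda=\lambda_{\tilde\Omega_+}$. *)

(* Defs.v *)
From HB Require Import structures.
From mathcomp Require Import all_boot all_order all_algebra.
From mathcomp Require Import boolp.

Set Implicit Arguments.
Unset Strict Implicit.
Unset Printing Implicit Defensive.

Import GRing.Theory.
Local Open Scope ring_scope.
Local Open Scope quotient_scope.

(* MathComp modules are left modules, so a right K-module is a left module
   over the converse ring K^c: for x : M and a : K, the element [a *: x] of
   [M : rmodType K] is the mathematical x.a, and (a : K^c) * (b : K^c) is
   b * a in K.  Rings are [pzRingType]s, so that the zero ring is allowed. *)
Notation rmodType K := (lmodType (K : pzRingType)^c).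

Record grading (P : pzRingType) := Grading {
  homog : nat -> {pred P};
  homog_zmod : forall k, zmod_closed (homog k);
  homog1 : 1 \in homog 0;
  homogM : forall i j x y,
    x \in homog i -> y \in homog j -> x * y \in homog (i + j);
  homog_span : forall x, exists s : seq P,
    (forall k, s`_k \in homog k) /\ x = \sum_(k < size s) s`_k;
  homog_free : forall s : seq P, (forall k, s`_k \in homog k) ->
    \sum_(k < size s) s`_k = 0 -> forall k, s`_k = 0
}.

Section Degree0.
Variables (P : pzRingType) (G : grading P).

Definition deg0 : {pred P} := homog G 0.

Fact deg0_subring : subring_closed deg0.
Proof.
split; first exact: homog1.
  exact: (homog_zmod G 0).2.
by move=> x y x0 y0; exact: (homogM x0 y0).
Qed.

Record R0 := MkR0 { R0_val :> P; R0_valP : R0_val \in deg0 }.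
HB.instance Definition _ := [isSub for R0_val].
HB.instance Definition _ := [Choice of R0 by <:].
HB.instance Definition _ := GRing.SubChoice_isSubPzRing.Build P deg0 R0
  deg0_subring.

Let homog0 k : 0 \in homog G k.
Proof. by have [] := homog_zmod G k. Qed.

Let homogB k x y : x \in homog G k -> y \in homog G k -> x - y \in homog G k.
Proof. by have [_] := homog_zmod G k; apply. Qed.

Let homogN k x : x \in homog G k -> - x \in homog G k.
Proof. by move=> xk; rewrite -sub0r homogB. Qed.

Let homogD k x y : x \in homog G k -> y \in homog G k -> x + y \in homog G k.
Proof. by move=> xk yk; rewrite -[y]opprK homogB ?homogN. Qed.

Definition decomposition (x : P) : seq P := sval (cid (homog_span G x)).

Definition component (k : nat) (x : P) : P := (decomposition x)`_k.

Lemma component_homog k x : component k x \in homog G k.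
Proof. by rewrite /component /decomposition; case: cid => s [/= + _]. Qed.

Let sum_nth_widen (s : seq P) n : (size s <= n)%N ->
  \sum_(k < size s) s`_k = \sum_(k < n) s`_k.
Proof.
move=> le_sn; rewrite (big_ord_widen n (fun k => s`_k)) //.
rewrite [RHS](bigID (fun k : 'I_n => (k < size s)%N)) /=.
by rewrite [X in _ + X]big1 ?addr0 // => i; rewrite -leqNgt => /(nth_default 0).
Qed.

Lemma component_unique (x : P) n (r : nat -> P) :
  (forall k, r k \in homog G k) -> x = \sum_(k < n) r k ->
  forall k, component k x = if (k < n)%N then r k else 0.
Proof.
move=> hr xE k; rewrite /component /decomposition.
case: cid => s [/= hs xs].
pose m := maxn k.+1 (maxn n (size s)).
pose r' i := if (i < n)%N then r i else 0.
pose t := mkseq (fun i => s`_i - r' i) m.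
have tE i : t`_i = if (i < m)%N then s`_i - r' i else 0.
  by case: ltnP => im; [rewrite nth_mkseq | rewrite nth_default ?size_mkseq].
have r'h i : r' i \in homog G i by rewrite /r'; case: ifP.
have th i : t`_i \in homog G i by rewrite tE; case: ifP => _; rewrite ?homogB.
have t0 : \sum_(i < size t) t`_i = 0.
  rewrite size_mkseq.
  under eq_bigr => i _ do rewrite tE ltn_ord.
  rewrite sumrB -sum_nth_widen -?xs; last by rewrite !leq_max leqnn !orbT.
  rewrite xE (big_ord_widen m r) ?leq_max ?leqnn ?orbT // big_mkcond /=.
  by rewrite subrr.
have := homog_free th t0 k.
by rewrite tE leq_max leqnn /= => /eqP; rewrite subr_eq0 => /eqP.
Qed.

Lemma component_sum x n : (size (decomposition x) <= n)%N ->
  x = \sum_(k < n) component k x.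
Proof.
rewrite /component => le_n; rewrite -sum_nth_widen // /decomposition.
by case: cid => s [].
Qed.

Definition tr0 (x : P) : R0 := MkR0 (component_homog 0 x).

Lemma tr0_homog k x : x \in homog G k ->
  R0_val (tr0 x) = if k == 0%N then x else 0.
Proof.
move=> xk; rewrite /= (@component_unique x k.+1
  (fun i => if i == k then x else 0)) //.
- by rewrite ltnS leq0n eq_sym.
- by move=> i; case: eqP => [->|].
- by rewrite -big_mkcond (big_pred1 ord_max).
Qed.

Fact tr0_is_zmod_morphism : zmod_morphism tr0.
Proof.
move=> x y; apply: val_inj => /=.
pose n := maxn 1 (maxn (size (decomposition x)) (size (decomposition y))).
have nx : (size (decomposition x) <= n)%N by rewrite !leq_max leqnn !orbT.
have ny : (size (decomposition y) <= n)%N by rewrite !leq_max leqnn !orbT.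
have n0 : (0 < n)%N by rewrite leq_max.
rewrite (@component_unique (x - y) n (fun k => component k x - component k y)).
- by rewrite n0.
- by move=> k; rewrite homogB ?component_homog.
- by rewrite sumrB -!component_sum.
Qed.

Fact tr0_is_monoid_morphism : monoid_morphism tr0.
Proof.
split=> [|x y]; apply: val_inj => /=.
  rewrite (@component_unique 1 1 (fun k => if k is 0 then 1 else 0)) //.
    by move=> [|k]; rewrite ?homog1 ?homog0.
  by rewrite big_ord1.
pose n := maxn 1 (maxn (size (decomposition x)) (size (decomposition y))).
have nx : (size (decomposition x) <= n)%N by rewrite !leq_max leqnn !orbT.
have ny : (size (decomposition y) <= n)%N by rewrite !leq_max leqnn !orbT.
have n0 : (0 < n)%N by rewrite leq_max.
pose c k := \sum_(i < n) \sum_(j < n | (i + j == k)%N)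
  component i x * component j y.
rewrite (@component_unique (x * y) (n + n).+1 c) /=.
- rewrite /c (bigD1 (Ordinal n0)) //= [X in _ + X]big1 ?addr0 => [|i i0].
    by rewrite (big_pred1 (Ordinal n0)) // => j; rewrite -val_eqE.
  rewrite big_pred0 // => j; rewrite addn_eq0; apply: contraNF i0.
  by case/andP=> /eqP i0 _; apply/eqP/val_inj.
- move=> k; apply: (big_ind (fun z => z \in homog G k)) => // [u v|i _].
    exact: homogD.
  apply: (big_ind (fun z => z \in homog G k)) => // [u v|j /eqP <-].
    exact: homogD.
  by rewrite homogM ?component_homog.
- rewrite {1}(component_sum nx) {1}(component_sum ny) big_distrlr /=.
  rewrite /c [RHS]exchange_big /=; apply: eq_bigr => i _.
  rewrite [RHS](exchange_big_dep xpredT) //=; apply: eq_bigr => j _.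
  have ij : (i + j < (n + n).+1)%N by rewrite ltnS leq_add // ltnW.
  by rewrite (big_pred1 (Ordinal ij)) // => k; rewrite -val_eqE eq_sym.
Qed.

HB.instance Definition _ := GRing.isZmodMorphism.Build P R0 tr0
  tr0_is_zmod_morphism.
HB.instance Definition _ := GRing.isMonoidMorphism.Build P R0 tr0
  tr0_is_monoid_morphism.

End Degree0.

Section Tensor.
Variables (P S : pzRingType) (f : {rmorphism P -> S}) (M : rmodType P).

(* The list [:: (x_1, a_1); ..; (x_n, a_n)] stands for the sum of the
   elementary tensors x_i (x) a_i. *)
Inductive tensor_eq : seq (M * S) -> seq (M * S) -> Prop :=
| tensor_refl u : tensor_eq u u
| tensor_sym u v : tensor_eq u v -> tensor_eq v u
| tensor_trans u v w : tensor_eq u v -> tensor_eq v w -> tensor_eq u w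
| tensor_cat u u' v v' :
    tensor_eq u u' -> tensor_eq v v' -> tensor_eq (u ++ v) (u' ++ v')
| tensor_catC u v : tensor_eq (u ++ v) (v ++ u)
| tensor_0l a : tensor_eq [:: (0, a)] [::]
| tensor_Dl x y a : tensor_eq [:: (x + y, a)] [:: (x, a); (y, a)]
| tensor_Dr x a b : tensor_eq [:: (x, a + b)] [:: (x, a); (x, b)]
| tensor_balanced (p : P) x a :
    tensor_eq [:: ((p : P^c) *: x, a)] [:: (x, f p * a)].

Definition tensor_rel : rel (seq (M * S)) := fun u v => `[< tensor_eq u v >].

Fact tensor_rel_refl : reflexive tensor_rel.
Proof. by move=> u; apply/asboolP/tensor_refl. Qed.

Fact tensor_rel_sym : symmetric tensor_rel.
Proof. by move=> u v; apply/asboolP/asboolP => /tensor_sym. Qed.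

Fact tensor_rel_trans : transitive tensor_rel.
Proof.
by move=> v u w /asboolP uv /asboolP vw; apply/asboolP/(tensor_trans uv).
Qed.

Canonical tensor_equiv :=
  EquivRel tensor_rel tensor_rel_refl tensor_rel_sym tensor_rel_trans.

Definition tensor := {eq_quot tensor_equiv}.
HB.instance Definition _ := Choice.on tensor.

Definition tensor_class (u : seq (M * S)) : tensor := \pi u.

Definition elem_tensor (x : M) (a : S) : tensor := tensor_class [:: (x, a)].

Lemma tensor_classP u v : tensor_class u = tensor_class v <-> tensor_eq u v.
Proof.
split=> [/eqmodP/asboolP //|uv]; exact/eqmodP/asboolP.
Qed.

Lemma tensor_reprK (t : tensor) : tensor_class (repr t) = t.
Proof. exact: reprK. Qed.

Lemma tensor_repr_eq u : tensor_eq (repr (tensor_class u)) u.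
Proof. exact/tensor_classP/tensor_reprK. Qed.

Definition tensor_zero : tensor := tensor_class [::].
Definition tensor_add (t u : tensor) : tensor :=
  tensor_class (repr t ++ repr u).
Definition tensor_opp (t : tensor) : tensor :=
  tensor_class [seq (- e.1, e.2) | e <- repr t].
Definition tensor_scale (b : S^c) (t : tensor) : tensor :=
  tensor_class [seq (e.1, (e.2 : S) * (b : S)) | e <- repr t].

Let opp_eq u v : tensor_eq u v ->
  tensor_eq [seq (- e.1, e.2) | e <- u] [seq (- e.1, e.2) | e <- v].
Proof.
elim=> {u v} /= [u|u v _|u v w _ uv _|u u' v v' _ + _|u v|a|x y a|x a b|p x a].
- exact: tensor_refl.
- exact: tensor_sym.
- exact: tensor_trans.
- by rewrite !map_cat; apply: tensor_cat.
- by rewrite !map_cat; apply: tensor_catC.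
- by rewrite oppr0; apply: tensor_0l.
- by rewrite opprD; apply: tensor_Dl.
- exact: tensor_Dr.
- by rewrite -scalerN; apply: tensor_balanced.
Qed.

Let scale_eq (b : S) u v : tensor_eq u v ->
  tensor_eq [seq (e.1, e.2 * b) | e <- u] [seq (e.1, e.2 * b) | e <- v].
Proof.
elim=> {u v} /= [u|u v _|u v w _ uv _|u u' v v' _ + _|u v|a|x y a|x a c|p x a].
- exact: tensor_refl.
- exact: tensor_sym.
- exact: tensor_trans.
- by rewrite !map_cat; apply: tensor_cat.
- by rewrite !map_cat; apply: tensor_catC.
- exact: tensor_0l.
- exact: tensor_Dl.
- by rewrite mulrDl; apply: tensor_Dr.
- by rewrite -mulrA; apply: tensor_balanced.
Qed.

Lemma tensor_classD u v :
  tensor_add (tensor_class u) (tensor_class v) = tensor_class (u ++ v).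
Proof. by apply/tensor_classP/tensor_cat; apply: tensor_repr_eq. Qed.

Lemma tensor_classN u : tensor_opp (tensor_class u) =
  tensor_class [seq (- e.1, e.2) | e <- u].
Proof. exact/tensor_classP/opp_eq/tensor_repr_eq. Qed.

Lemma tensor_classZ (b : S) u : tensor_scale b (tensor_class u) =
  tensor_class [seq (e.1, e.2 * b) | e <- u].
Proof. exact/tensor_classP/scale_eq/tensor_repr_eq. Qed.

Fact tensor_addA : associative tensor_add.
Proof.
move=> t u v; rewrite -[t]tensor_reprK -[u]tensor_reprK -[v]tensor_reprK.
by rewrite !tensor_classD catA.
Qed.

Fact tensor_addC : commutative tensor_add.
Proof. by move=> t u; apply/tensor_classP/tensor_catC. Qed.

Fact tensor_add0 : left_id tensor_zero tensor_add.
Proof. by move=> t; rewrite -[t]tensor_reprK tensor_classD. Qed.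

Fact tensor_addN : left_inverse tensor_zero tensor_opp tensor_add.
Proof.
move=> t; rewrite -[t]tensor_reprK tensor_classN tensor_classD.
elim: (repr t) => [|[x a] u IHu] //=; rewrite -IHu.
rewrite -cat1s -[(x, a) :: u]cat1s -!tensor_classD.
rewrite [X in tensor_add _ X]tensor_addC -tensor_addA tensor_addA.
rewrite [X in tensor_add _ X]tensor_addC [X in tensor_add X _](_ : _ = tensor_zero).
  by rewrite tensor_add0.
rewrite tensor_classD; apply/tensor_classP.
apply: tensor_trans (tensor_0l a); apply: tensor_sym.
by rewrite -(addNr x); apply: tensor_Dl.
Qed.

HB.instance Definition _ := GRing.isZmodule.Build tensor
  tensor_addA tensor_addC tensor_add0 tensor_addN.

Lemma tensor_class_cons e u :
  tensor_class (e :: u) = elem_tensor e.1 e.2 + tensor_class u.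
Proof. by case: e => x a; rewrite [RHS]tensor_classD. Qed.

Lemma elem_tensorDr x a b :
  elem_tensor x (a + b) = elem_tensor x a + elem_tensor x b.
Proof.
by rewrite [RHS]tensor_classD; apply/tensor_classP/tensor_Dr.
Qed.

Fact tensor_scaleA (a b : S^c) t :
  tensor_scale a (tensor_scale b t) = tensor_scale (a * b) t.
Proof.
rewrite -[t]tensor_reprK !tensor_classZ -map_comp; congr tensor_class.
by apply: eq_map => e /=; rewrite -mulrA.
Qed.

Fact tensor_scale1 : left_id 1 tensor_scale.
Proof.
move=> t; rewrite -[t]tensor_reprK tensor_classZ; congr tensor_class.
by rewrite -[RHS]map_id; apply: eq_map => -[x a] /=; rewrite mulr1.
Qed.

Fact tensor_scaleDr : right_distributive tensor_scale +%R.
Proof.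
move=> b t u; rewrite -[t]tensor_reprK -[u]tensor_reprK.
by rewrite [_ + _]tensor_classD !tensor_classZ map_cat -tensor_classD.
Qed.

Fact tensor_scaleDl t : {morph tensor_scale^~ t : a b / a + b}.
Proof.
move=> b c; rewrite -[t]tensor_reprK !tensor_classZ.
elim: (repr t) => [|[x a] u IHu] /=; first by rewrite [RHS]tensor_classD.
rewrite !tensor_class_cons [X in _ + X = _]IHu addrACA; congr (_ + _).
by rewrite mulrDr; apply: elem_tensorDr.
Qed.

HB.instance Definition _ := GRing.Zmodule_isLmodule.Build S^c tensor
  tensor_scaleA tensor_scale1 tensor_scaleDr tensor_scaleDl.

Lemma tensor_universal (A : zmodType) (beta : M -> S -> A) :
    (forall x y a, beta (x + y) a = beta x a + beta y a) ->
    (forall x a b, beta x (a + b) = beta x a + beta x b) ->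
    (forall (p : P) x a, beta ((p : P^c) *: x) a = beta x (f p * a)) ->
  exists g : {additive tensor -> A},
    (forall x a, g (elem_tensor x a) = beta x a) /\
    (forall g' : {additive tensor -> A},
       (forall x a, g' (elem_tensor x a) = beta x a) -> g' =1 g).
Proof.
move=> bDl bDr bb.
pose h (u : seq (M * S)) := \sum_(e <- u) beta e.1 e.2.
have hP u v : tensor_eq u v -> h u = h v.
  rewrite /h; elim=> {u v}
    // [u v w _ -> //|u u' v v' _ IHu _ IHv|u v|a|x y a|x a b|p x a].
  - by rewrite !big_cat IHu IHv.
  - by rewrite !big_cat; apply: addrC.
  - rewrite big_seq1 big_nil /=; apply: (addrI (beta 0 a)).
    by rewrite -bDl !addr0.
  - by rewrite big_seq1 big_cons big_seq1 /= bDl.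
  - by rewrite big_seq1 big_cons big_seq1 /= bDr.
  - by rewrite !big_seq1 /= bb.
pose g (t : tensor) := h (repr t).
have gE u : g (tensor_class u) = h u by exact/hP/tensor_repr_eq.
have gD : zmod_morphism g.
  have gD' : {morph g : t u / t + u}.
    move=> t u; rewrite -[t]tensor_reprK -[u]tensor_reprK.
    by rewrite [_ + _]tensor_classD !gE /h big_cat.
  by move=> t u; apply: (addIr (g u)); rewrite -gD' !subrK.
pose gA := GRing.isZmodMorphism.Build _ _ g gD.
pose gg : {additive tensor -> A} := HB.pack g gA.
exists gg; split=> [x a|g' g'E t]; first by rewrite [LHS]gE /h big_seq1.
rewrite -[t]tensor_reprK [RHS]gE /h.
elim: (repr t) => [|[x a] u IHu].
  by rewrite big_nil; exact: (raddf0 g').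
by rewrite big_cons -IHu -g'E -raddfD tensor_class_cons.
Qed.

End Tensor.

Section TensorMap.
Variables (P S : pzRingType) (f : {rmorphism P -> S}) (M N : rmodType P).
Variable sigma : {linear M -> N}.

Definition tensor_map (t : tensor f M) : tensor f N :=
  tensor_class f [seq (sigma e.1, e.2) | e <- repr t].

Let map_eq u v : tensor_eq f u v -> tensor_eq f
  [seq (sigma e.1, e.2) | e <- u] [seq (sigma e.1, e.2) | e <- v].
Proof.
elim=> {u v} /= [u|u v _|u v w _ uv _|u u' v v' _ + _|u v|a|x y a|x a b|p x a].
- exact: tensor_refl.
- exact: tensor_sym.
- exact: tensor_trans.
- by rewrite !map_cat; apply: tensor_cat.
- by rewrite !map_cat; apply: tensor_catC.
- by rewrite raddf0; apply: tensor_0l.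
- by rewrite raddfD; apply: tensor_Dl.
- exact: tensor_Dr.
- by rewrite linearZ; apply: tensor_balanced.
Qed.

Lemma tensor_map_class u : tensor_map (tensor_class f u) =
  tensor_class f [seq (sigma e.1, e.2) | e <- u].
Proof. exact/tensor_classP/map_eq/tensor_repr_eq. Qed.

Lemma tensor_map_elem x a :
  tensor_map (elem_tensor f x a) = elem_tensor f (sigma x) a.
Proof. exact: tensor_map_class. Qed.

Fact tensor_map_is_linear : linear tensor_map.
Proof.
move=> b t u; rewrite -[t]tensor_reprK -[u]tensor_reprK.
rewrite [_ *: _]tensor_classZ [_ + _]tensor_classD !tensor_map_class.
rewrite [_ *: _]tensor_classZ [RHS]tensor_classD map_cat -!map_comp.
by congr (tensor_class _ (_ ++ _)).
Qed.

HB.instance Definition _ := GRing.isLinear.Build S^c (tensor f M) (tensor f N)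
  *:%R tensor_map tensor_map_is_linear.

End TensorMap.
Arguments tensor_map {P S} f {M N} sigma t.

Record complex (K : pzRingType) := Complex {
  chain : int -> rmodType K;
  bdry : forall k : int, {linear chain (k + 1) -> chain k};
  bdryK : forall (k : int) (x : chain (k + 1 + 1)), bdry k (bdry (k + 1) x) = 0
}.

Definition bounded (K : pzRingType) (C : complex K) : Prop :=
  exists m n : int, forall k : int, (k < m) || (n < k) ->
  forall x : chain C k, x = 0.

(* The module C_(k + 1), for k ranging over all integers, is an arbitrary term
   of C: indexing the homotopy identity this way avoids transports. *)
Definition contractible (K : pzRingType) (C : complex K) : Prop :=
  exists h : forall k : int, {linear chain C k -> chain C (k + 1)},
  forall (k : int) (x : chain C (k + 1)),
    bdry C (k + 1) (h (k + 1) x) + h k (bdry C k x) = x.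

Definition fg_free (K : pzRingType) (M : rmodType K) : Prop :=
  exists (n : nat) (b : 'I_n -> M), forall x : M,
  exists! c : {ffun 'I_n -> K}, x = \sum_(i < n) (c i : K^c) *: b i.

Definition bounded_fg_free (K : pzRingType) (C : complex K) : Prop :=
  bounded C /\ forall k, fg_free (chain C k).

Section TensorComplex.
Variables (P S : pzRingType) (f : {rmorphism P -> S}) (C : complex P).

Fact tensor_bdryK (k : int) (t : tensor f (chain C (k + 1 + 1))) :
  tensor_map f (bdry C k) (tensor_map f (bdry C (k + 1)) t) = 0.
Proof.
rewrite -[t]tensor_reprK !tensor_map_class -map_comp.
elim: (repr t) => [|[x a] u IHu] //=.
rewrite tensor_class_cons IHu addr0 bdryK.
exact/tensor_classP/tensor_0l.
Qed.

Definition tensor_complex : complex S :=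
  @Complex S (fun k => tensor f (chain C k))
    (fun k => tensor_map f (bdry C k)) tensor_bdryK.

End TensorComplex.

Definition hom_set (K : pzRingType) :=
  forall M N : rmodType K, {linear M -> N} -> Prop.

Definition inverting (K S : pzRingType) (Sigma : hom_set K)
    (f : {rmorphism K -> S}) : Prop :=
  forall (M N : rmodType K) (sigma : {linear M -> N}),
  Sigma M N sigma -> bijective (tensor_map f sigma).

Definition factors_uniquely (P L S : pzRingType)
    (lambda : {rmorphism P -> L}) (f : {rmorphism P -> S}) : Prop :=
  exists eta : {rmorphism L -> S}, f =1 eta \o lambda /\
  forall eta' : {rmorphism L -> S}, f =1 eta' \o lambda -> eta' =1 eta.

Definition is_localisation (K L : pzRingType) (Sigma : hom_set K)
    (lambda : {rmorphism K -> L}) : Prop :=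
  inverting Sigma lambda /\
  forall (S : pzRingType) (f : {rmorphism K -> S}),
    inverting Sigma f -> factors_uniquely lambda f.

(* The right module K^k, as the column vectors over K^c: the scalar action
   multiplies the entries by elements of K on the right. *)
Notation colmod K k := 'cV[(K : pzRingType)^c]_k.

Section MatrixHom.
Variables (K : pzRingType) (k : nat) (A : 'M[K]_k).

Definition mx_hom (v : colmod K k) : colmod K k := A *m (v : 'cV[K]_k).

Fact mx_hom_is_linear : linear mx_hom.
Proof.
move=> a u v; apply/matrixP => i j; rewrite !mxE.
under eq_bigr => l _ do rewrite !mxE mulrDr.
rewrite big_split /=; congr (_ + _).
by rewrite [RHS]mulr_suml; apply: eq_bigr => l _; rewrite mulrA.
Qed.

HB.instance Definition _ := GRing.isLinear.Build K^c (colmod K k) (colmod K k)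
  *:%R mx_hom mx_hom_is_linear.

End MatrixHom.

(* [unitmx] is only available over commutative rings. *)
Definition mx_invertible (K : pzRingType) (k : nat) (A : 'M[K]_k) : Prop :=
  exists B : 'M[K]_k, A *m B = 1%:M /\ B *m A = 1%:M.

Inductive Omega_plus (P : pzRingType) (G : grading P) : hom_set P :=
  OmegaPlus (k : nat) (A : 'M[P]_k) of mx_invertible (map_mx (tr0 G) A) :
    Omega_plus G (mx_hom A).
Arguments Omega_plus {P} G M N sigma.

Definition preserves_R0_contractibility (P S : pzRingType) (G : grading P)
    (f : {rmorphism P -> S}) : Prop :=
  forall C : complex P, bounded_fg_free C ->
  contractible (tensor_complex (tr0 G) C) -> contractible (tensor_complex f C).

(* Main.v *)
(* R_0 is a subring of P splitting tr^0, so a contraction of C (x) R_0 lifts to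
   maps h on the free modules of C.  The chain map T = d h + h d reduces to the
   identity over R_0, hence T (x) L is invertible, and (T (x) L)^-1 h contracts
   C (x) L.  Conversely, a matrix A is inverted over S as soon as the two-term
   complex P^n -A-> P^n becomes contractible over S. *)
Require Import Defs.
From HB Require Import structures.
From mathcomp Require Import all_boot all_order all_algebra.
From mathcomp Require Import boolp.

Set Implicit Arguments.
Unset Strict Implicit.
Unset Printing Implicit Defensive.

Import GRing.Theory.
Local Open Scope ring_scope.

Lemma linear_inverse (R : pzRingType) (U V : lmodType R)
    (g : {linear U -> V}) :
  bijective g -> exists g' : {linear V -> U}, cancel g g' /\ cancel g' g.
Proof.
case=> g' gK g'K.
have lin : linear g' by move=> a u v; apply: (can_inj gK); rewrite linearP !g'K.
pose g'l : {linear V -> U} :=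
  HB.pack g' (GRing.isLinear.Build _ _ _ _ g' lin).
by exists g'l.
Qed.

(** * Base change along a ring homomorphism, and finitely generated free modules *)

Section TensorTheory.
Variables (P S : pzRingType) (f : {rmorphism P -> S}).
Implicit Types M N Q : rmodType P.

Lemma elem_tensorDl M (x y : M) a :
  elem_tensor f (x + y) a = elem_tensor f x a + elem_tensor f y a.
Proof. by rewrite [RHS]tensor_classD; apply/tensor_classP/tensor_Dl. Qed.

Lemma elem_tensorZ M (x : M) (a : S) :
  elem_tensor f x a = (a : S^c) *: elem_tensor f x 1.
Proof. by rewrite [RHS]tensor_classZ /= mul1r. Qed.

Lemma elem_tensorZl M (p : P) (x : M) :
  elem_tensor f ((p : P^c) *: x) 1 = (f p : S^c) *: elem_tensor f x 1.
Proof.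
by rewrite -elem_tensorZ -[f p]mulr1; apply/tensor_classP/tensor_balanced.
Qed.

Lemma elem_tensor_sum M n (x : 'I_n -> M) a :
  elem_tensor f (\sum_i x i) a = \sum_i elem_tensor f (x i) a.
Proof.
elim/big_rec2: _ => [|i y z _ <-]; last exact: elem_tensorDl.
exact/tensor_classP/tensor_0l.
Qed.

Lemma tensor_ext M (T : zmodType) (g g' : {additive tensor f M -> T}) :
  (forall x a, g (elem_tensor f x a) = g' (elem_tensor f x a)) -> g =1 g'.
Proof.
move=> gg' t; rewrite -[t]tensor_reprK; elim: (repr t) => [|[x a] u IHu].
  by rewrite [tensor_class f [::]](_ : _ = 0) // !raddf0.
by rewrite tensor_class_cons !raddfD gg' IHu.
Qed.

(** The elements b_i ⊗ 1 generate M ⊗ S over S, because scalars of P move across the tensor sign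
    through [f]. *)
Lemma tensor_ext_span M (T : rmodType S) (g g' : {linear tensor f M -> T})
    n (b : 'I_n -> M) :
  (forall x, exists c : 'I_n -> P, x = \sum_i (c i : P^c) *: b i) ->
  (forall i, g (elem_tensor f (b i) 1) = g' (elem_tensor f (b i) 1)) ->
  g =1 g'.
Proof.
move=> span gg'; apply: tensor_ext => x a /=; have [c ->] := span x.
rewrite elem_tensorZ !linearZ elem_tensor_sum !linear_sum.
by congr (_ *: _); apply: eq_bigr => i _; rewrite elem_tensorZl !linearZ gg'.
Qed.

Lemma tensor_map_comp M N Q (s : {linear M -> N}) (r : {linear N -> Q})
    (q : {linear M -> Q}) :
  q =1 r \o s -> tensor_map f q =1 tensor_map f r \o tensor_map f s.
Proof.
move=> qE; apply: (@tensor_ext _ _ (tensor_map f q)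
  (tensor_map f r \o tensor_map f s)) => x a.
by rewrite /= !tensor_map_elem qE.
Qed.

Lemma tensor_map_id M (s : {linear M -> M}) :
  s =1 id -> tensor_map f s =1 id.
Proof.
move=> sE; apply: (@tensor_ext _ _ (tensor_map f s) idfun) => x a.
by rewrite /= !tensor_map_elem sE.
Qed.

Lemma tensor_mapD M N (s r q : {linear M -> N}) :
  q =1 s \+ r -> tensor_map f q =1 tensor_map f s \+ tensor_map f r.
Proof.
move=> qE; apply: (@tensor_ext _ _ (tensor_map f q)
  (tensor_map f s \+ tensor_map f r)) => x a.
by rewrite /= !tensor_map_elem qE elem_tensorDl.
Qed.

Lemma tensor_trivial M : (forall x : M, x = 0) ->
  forall t : tensor f M, t = 0.
Proof.
move=> M0; apply: (@tensor_ext _ _ idfun \0) => x a /=.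
by rewrite (M0 x); apply/tensor_classP/tensor_0l.
Qed.

Lemma colmod_span n (x : colmod P n) :
  x = \sum_i (x i 0 : P^c) *: (delta_mx i 0 : colmod P n).
Proof.
apply/matrixP => i j; rewrite ord1 summxE (bigD1 i) //= big1 => [|l li].
  by rewrite !mxE !eqxx mulr1 addr0.
by rewrite !mxE eq_sym (negPf li) mulr0.
Qed.

Lemma mx_hom_delta n (A : 'M[P]_n) (j : 'I_n) :
  mx_hom A (delta_mx j 0) = col j A.
Proof.
apply/matrixP => i k; rewrite ord1 !mxE (bigD1 j) //= big1 => [|l lj].
  by rewrite !mxE !eqxx mulr1 addr0.
by rewrite !mxE (negPf lj) mulr0.
Qed.

(** The j-th column gives (sum_i e_i a_ij) ⊗ 1 = sum_i (e_i ⊗ 1) f(a_ij), so base change sees only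
    the entries under [f]. *)
Lemma tensor_map_mx_hom n (A B : 'M[P]_n) : map_mx f A = map_mx f B ->
  tensor_map f (mx_hom A) =1 tensor_map f (mx_hom B).
Proof.
move=> AB; apply: (@tensor_ext_span _ _ _ _ n (fun i => delta_mx i 0)) => [x|j].
  by exists (fun i => x i 0); exact: colmod_span.
rewrite /= !tensor_map_elem /= !mx_hom_delta.
rewrite [col j A]colmod_span [col j B]colmod_span !elem_tensor_sum.
apply: eq_bigr => i _; rewrite !elem_tensorZl !mxE.
by have := congr1 (fun X : 'M_n => X i j) AB; rewrite !mxE => ->.
Qed.

(** The coordinate map u ⊗ a |-> f(u_i) a is balanced, hence well defined on the tensor product, and
    it recovers f(x_i) from x ⊗ 1. *)
Lemma elem_tensor_colmod_inj n (x y : colmod P n) :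
  elem_tensor f x 1 = elem_tensor f y 1 -> forall i, f (x i 0) = f (y i 0).
Proof.
move=> xy i; have [||p u a|g [gE _]] := @tensor_universal _ _ f (colmod P n) S
  (fun u a => f (u i 0) * a).
- by move=> u v a; rewrite mxE rmorphD mulrDl.
- by move=> u a b; rewrite mulrDr.
- by rewrite mxE rmorphM mulrA.
by have := congr1 g xy; rewrite !gE !mulr1.
Qed.

Lemma linear_mx_hom n (s : {linear colmod P n -> colmod P n}) :
  exists A, s =1 mx_hom A.
Proof.
exists (\matrix_(i, j) s (delta_mx j 0) i 0) => x.
rewrite [x]colmod_span linear_sum (linear_sum (mx_hom _)).
apply: eq_bigr => j _; rewrite linearZ [RHS]linearZ /= mx_hom_delta; congr (_ *: _).
by apply/matrixP => i k; rewrite ord1 !mxE.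
Qed.

Lemma fg_free_iso M : fg_free M ->
  exists n (g : {linear colmod P n -> M}), bijective g.
Proof.
case=> n [b bP]; exists n.
pose g (v : colmod P n) := \sum_i (v i 0 : P^c) *: b i.
have lin : linear g.
  move=> a u v; rewrite /g scaler_sumr -big_split; apply: eq_bigr => i _.
  by rewrite !mxE scalerDl scalerA.
pose gl : {linear colmod P n -> M} :=
  HB.pack g (GRing.isLinear.Build _ _ _ _ g lin).
exists gl; pose c x := sval (cid (bP x)).
have cP x : x = \sum_i (c x i : P^c) *: b i /\
    (forall d : {ffun 'I_n -> P}, x = \sum_i (d i : P^c) *: b i -> c x = d).
  by rewrite /c; case: cid.
exists (fun x => \col_i (c x i : P^c)) => [v|x].
  apply/matrixP => i j; rewrite ord1 mxE.
  rewrite ((cP (g v)).2 [ffun i => v i 0]) ?ffunE //.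
  by apply: eq_bigr => k _; rewrite ffunE.
by rewrite [RHS](cP x).1; apply: eq_bigr => i _; rewrite mxE.
Qed.

(** Writing a = f(p) turns x ⊗ a into xp ⊗ 1, so a sum of elementary tensors collapses to a single
    one. *)
Lemma elem_tensor_surj M : (forall s, exists p, f p = s) ->
  forall t : tensor f M, exists x, t = elem_tensor f x 1.
Proof.
move=> fs t; rewrite -[t]tensor_reprK; elim: (repr t) => [|[x a] u [y IHu]].
  by exists 0; apply/esym/tensor_classP/tensor_0l.
have [p pa] := fs a; exists ((p : P^c) *: x + y).
by rewrite tensor_class_cons IHu elem_tensorDl elem_tensorZl pa -elem_tensorZ.
Qed.

Lemma fg_free_lift M N (h : {linear tensor f M -> tensor f N}) :
    (forall s, exists p, f p = s) -> fg_free M ->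
  exists h' : {linear M -> N}, tensor_map f h' =1 h.
Proof.
move=> fs /fg_free_iso [n [g /linear_inverse [g' [gK g'K]]]].
(* By freeness a lift may be prescribed on a basis: y_i is any element such that y_i ⊗ 1 is the
   image under [h] of the i-th basis vector tensored with 1. *)
have [y yE] := choice (fun i : 'I_n => elem_tensor_surj fs
  (h (elem_tensor f (g (delta_mx i 0)) 1))).
pose k (v : colmod P n) := \sum_i (v i 0 : P^c) *: y i.
have lin : linear k.
  move=> a u v; rewrite /k scaler_sumr -big_split; apply: eq_bigr => i _.
  by rewrite !mxE scalerDl scalerA.
pose kl : {linear colmod P n -> N} :=
  HB.pack k (GRing.isLinear.Build _ _ _ _ k lin).
exists (kl \o g').
apply: (@tensor_ext_span _ _ _ _ n (fun i => g (delta_mx i 0))) => [x|i].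
  exists (fun i => g' x i 0).
  rewrite -{1}[x]g'K {1}[g' x]colmod_span linear_sum.
  by apply: eq_bigr => i _; rewrite linearZ.
rewrite /= tensor_map_elem /= gK yE; congr (elem_tensor f _ 1).
rewrite /k (bigD1 i) //= big1 => [|j ji].
  by rewrite !mxE !eqxx scale1r addr0.
by rewrite !mxE (negPf ji) scale0r.
Qed.

End TensorTheory.

(** * From contractions over R_0 to contractions over the localisation *)

Lemma R0_valK (P : pzRingType) (G : grading P) (a : R0 G) : tr0 G a = a.
Proof. exact/val_inj/(tr0_homog (R0_valP a)). Qed.

(** In a basis of M, [s] becomes a matrix A with tr^0(A) = 1. Such an A lies in [Omega_plus], so
    [lambda] inverts it. *)
Lemma inverting_endomorphism (P L : pzRingType) (G : grading P)
    (lambda : {rmorphism P -> L}) (M : rmodType P) (s : {linear M -> M}) :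
  inverting (Omega_plus G) lambda -> fg_free M ->
  tensor_map (tr0 G) s =1 id -> bijective (tensor_map lambda s).
Proof.
move=> inv /fg_free_iso [n [g /linear_inverse [g' [gK g'K]]]] s1.
have [A AE] := linear_mx_hom (g' \o s \o g).
have trA : map_mx (tr0 G) A = 1%:M.
  apply/matrixP => i j; rewrite mxE.
  (* As [s] is the identity over R_0, A e_j and e_j agree there; comparing i-th coordinates gives
     the (i, j) entry of tr^0(A). *)
  have : elem_tensor (tr0 G) (mx_hom A (delta_mx j 0)) 1 =
         elem_tensor (tr0 G) (delta_mx j 0 : colmod P n) 1.
    rewrite -AE /= -[LHS](tensor_map_elem (tr0 G) g').
    by rewrite -tensor_map_elem s1 tensor_map_elem gK.
  move/elem_tensor_colmod_inj/(_ i); rewrite mx_hom_delta !mxE => ->.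
  by rewrite eqxx andbT; case: eqP => _; rewrite ?rmorph1 ?rmorph0.
have [|k Ak kA] := inv _ _ (mx_hom A).
  by apply: OmegaPlus; exists 1%:M; rewrite trA mulmx1.
have gT x : tensor_map lambda g (tensor_map lambda g' x) = x.
  by rewrite -[LHS](@tensor_map_comp _ _ lambda _ _ _ g' g idfun) ?tensor_map_id
     // => y /=; rewrite g'K.
have gT' x : tensor_map lambda g' (tensor_map lambda g x) = x.
  by rewrite -[LHS](@tensor_map_comp _ _ lambda _ _ _ g g' idfun) ?tensor_map_id
     // => y /=; rewrite gK.
have sE x : tensor_map lambda s x = tensor_map lambda g
    (tensor_map lambda (mx_hom A) (tensor_map lambda g' x)).
  rewrite -[tensor_map lambda (mx_hom A) _]
    (@tensor_map_comp _ _ lambda _ _ _ g' (mx_hom A) (mx_hom A \o g')) //.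
  rewrite -[RHS](@tensor_map_comp _ _ lambda _ _ _ (mx_hom A \o g') g s) //.
  by move=> y; rewrite /= -AE /= !g'K.
exists (tensor_map lambda g \o k \o tensor_map lambda g') => x /=.
  by rewrite sE gT' Ak gT.
by rewrite sE gT' kA gT.
Qed.

Lemma inverting_preserves_contractibility (P L : pzRingType) (G : grading P)
    (lambda : {rmorphism P -> L}) :
  inverting (Omega_plus G) lambda -> preserves_R0_contractibility G lambda.
Proof.
move=> inv C [_ free] [h0 h0P].
have tr_surj s : exists p, tr0 G p = s by exists (R0_val s); exact: R0_valK.
pose h k := sval (cid (fg_free_lift (h0 k) tr_surj (free k))).
have hP k : tensor_map (tr0 G) (h k) =1 h0 k by rewrite /h; case: cid.
pose T k : {linear chain C (k + 1) -> chain C (k + 1)} :=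
  (bdry C (k + 1) \o h (k + 1)) \+ (h k \o bdry C k).
have T_tensor (S : pzRingType) (f : {rmorphism P -> S}) k x :
    tensor_map f (T k) x =
      tensor_map f (bdry C (k + 1)) (tensor_map f (h (k + 1)) x) +
      tensor_map f (h k) (tensor_map f (bdry C k) x).
  rewrite (@tensor_mapD _ _ f _ _ (bdry C (k + 1) \o h (k + 1))
    (h k \o bdry C k) (T k)) //=.
  by congr (_ + _); apply: tensor_map_comp.
have T1 k : tensor_map (tr0 G) (T k) =1 id.
  by move=> x; rewrite T_tensor !hP; apply: h0P.
have Tbij k := inverting_endomorphism inv (free (k + 1)) (T1 k).
pose U k := sval (cid (linear_inverse (Tbij k))).
have TK k : cancel (tensor_map lambda (T k)) (U k).
  by rewrite /U; case: cid => ? [].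
have UK k : cancel (U k) (tensor_map lambda (T k)).
  by rewrite /U; case: cid => ? [].
(* T is a chain map: since d d = 0, both sides reduce to d h d. *)
have dT k x : tensor_map lambda (bdry C (k + 1)) (tensor_map lambda (T (k + 1)) x)
    = tensor_map lambda (T k) (tensor_map lambda (bdry C (k + 1)) x).
  by rewrite !T_tensor /= !raddfD /= !tensor_bdryK raddf0 add0r addr0.
exists (fun k => U k \o tensor_map lambda (h k)) => k x /=.
(* Apply the injective T to the homotopy identity and move it past d; then T U = 1 leaves d h x + h
   d x = T x. *)
apply: (can_inj (TK k)); rewrite raddfD /= [X in X + _ = _](esym (dT _ _)) !UK.
by rewrite T_tensor.
Qed.

(** * Two-term complexes of square matrices, and the universal property *)

Section TwoTerm.
Variables (P : pzRingType) (n : nat) (A : 'M[P]_n).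

Definition two_term_rank (k : int) : nat :=
  match k with Posz 0 | Posz 1 => n | _ => 0 end.

Definition two_term_chain (k : int) : rmodType P := colmod P (two_term_rank k).

(** [mx_hom A] has the required type because 0 + 1 computes to [Posz 1], so both ranks reduce to
    [n]. *)
Definition two_term_bdry (k : int) :
    {linear two_term_chain (k + 1) -> two_term_chain k} :=
  match k with
  | Posz 0 => mx_hom A
  | _ => \0
  end.

Fact two_term_bdryK (k : int) (x : two_term_chain (k + 1 + 1)) :
  two_term_bdry k (two_term_bdry (k + 1) x) = 0.
Proof.
case: k x => [[|k]|k] x //.
(* Only k = 0 is left: the outer map is [mx_hom A], and the inner one, out of degree 2, is zero. *)
by rewrite [two_term_bdry _ x](_ : _ = 0) ?raddf0.
Qed.

Definition two_term : complex P := Complex two_term_bdryK.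

Lemma two_term_trivial (k : int) : two_term_rank k = 0 ->
  forall x : two_term_chain k, x = 0.
Proof. by rewrite /two_term_chain => -> x; apply/matrixP => -[]. Qed.

Lemma two_term_bounded_fg_free : bounded_fg_free two_term.
Proof.
split=> [|k].
  exists 0, 1 => k k01; apply: two_term_trivial.
  by case: k k01 => [[|[|k]]|k].
exists (two_term_rank k), (fun i => delta_mx i 0) => x.
exists [ffun i => x i 0]; split=> [|c xE].
  by rewrite {1}[x]colmod_span; apply: eq_bigr => i _; rewrite ffunE.
apply/ffunP => i; rewrite ffunE xE summxE (bigD1 i) //= big1 => [|j ji].
  by rewrite !mxE !eqxx addr0; exact: mul1r.
by rewrite !mxE eq_sym (negPf ji) mulr0.
Qed.

(** In degrees 1 and 0 the homotopy identity says that [h 0] is a left and a right inverse of the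
    boundary; in all other degrees it holds in a zero module. *)
Lemma two_term_contractible (S : pzRingType) (f : {rmorphism P -> S}) :
  contractible (tensor_complex f two_term) <->
  bijective (tensor_map f (mx_hom A)).
Proof.
split=> [[h hP]|/linear_inverse [g [gK Kg]]].
- exists (h 0) => x.
    have := hP 0 x.
    rewrite [h (0 + 1) x](_ : _ = 0) ?linear0;
      first by apply: etrans; apply/esym/add0r.
    by apply: tensor_trivial; apply: two_term_trivial.
  (* [Negz 0] is -1, and the identity indexed by k lives in degree k + 1, here degree 0. *)
  have := hP (Negz 0) x.
  rewrite [bdry _ (Negz 0) x](_ : _ = 0) ?linear0;
      first by apply: etrans; apply/esym/addr0.
  by apply: tensor_trivial; apply: two_term_trivial.
- pose h k : {linear tensor f (two_term_chain k) ->
                     tensor f (two_term_chain (k + 1))} :=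
    match k with Posz 0 => g | _ => \0 end.
  exists h => -[[|k]|[|k]] x.
  + rewrite [h (0 + 1) x](_ : _ = 0) // linear0.
    by apply: etrans (add0r _) _; exact: gK.
  + have M0 : two_term_rank (Posz k.+1 + 1) = 0 by rewrite -PoszD addn1.
    rewrite [LHS](tensor_trivial (two_term_trivial M0)).
    exact/esym/(tensor_trivial (two_term_trivial M0)).
  + rewrite [h (Negz 0) _](_ : _ = 0) //.
    by apply: etrans (addr0 _) _; exact: Kg.
  + have M0 : two_term_rank (Negz k.+1 + 1) = 0 by [].
    rewrite [LHS](tensor_trivial (two_term_trivial M0)).
    exact/esym/(tensor_trivial (two_term_trivial M0)).
Qed.

End TwoTerm.

(** The inverse B over R_0 is read over P through the inclusion of R_0. The products of A with B'
    need not be 1 over P, but tr^0 sends them to 1, and base change to R_0 sees only that. *)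
Lemma tensor_map_tr0_bij (P : pzRingType) (G : grading P) n (A : 'M[P]_n) :
  mx_invertible (map_mx (tr0 G) A) -> bijective (tensor_map (tr0 G) (mx_hom A)).
Proof.
case=> B [AB BA]; pose B' : 'M[P]_n := map_mx (@R0_val P G) B.
have B'K : map_mx (tr0 G) B' = B.
  by apply/matrixP => i j; rewrite !mxE R0_valK.
have id1 X : map_mx (tr0 G) X = 1%:M ->
    tensor_map (tr0 G) (mx_hom X : {linear colmod P n -> colmod P n}) =1 id.
  move=> X1 x; rewrite (@tensor_map_mx_hom _ _ _ _ _ 1%:M) ?X1 ?map_mx1 //.
  by apply: tensor_map_id => v; rewrite /= /mx_hom mul1mx.
exists (tensor_map (tr0 G) (mx_hom B')) => x.
  rewrite -[LHS](@tensor_map_comp _ _ (tr0 G) _ _ _ (mx_hom A) (mx_hom B')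
    (mx_hom (B' *m A))) => [|v]; last by rewrite /= /mx_hom mulmxA.
  by apply: id1; rewrite map_mxM B'K.
rewrite -[LHS](@tensor_map_comp _ _ (tr0 G) _ _ _ (mx_hom B') (mx_hom A)
  (mx_hom (A *m B'))) => [|v]; last by rewrite /= /mx_hom mulmxA.
by apply: id1; rewrite map_mxM B'K.
Qed.

Theorem theorem5p5 (P : pzRingType) (G : grading P) (L : pzRingType)
    (lambda : {rmorphism P -> L}) :
  is_localisation (Omega_plus G) lambda ->
  preserves_R0_contractibility G lambda /\
  forall (S : pzRingType) (f : {rmorphism P -> S}),
    preserves_R0_contractibility G f -> factors_uniquely lambda f.
Proof.
case=> inv univ; split; first exact: inverting_preserves_contractibility.
move=> S f fP; apply: univ => M N _ [n A invA].
(* Inverting A over S amounts to contractibility of its two-term complex over S, which [fP] reduces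
   to contractibility over R_0. *)
apply/two_term_contractible/fP; first exact: two_term_bounded_fg_free.
exact/two_term_contractible/tensor_map_tr0_bij.
Qed.
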